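(* Let $n\ge1$, let $(M,\omega)$ be a pre-$n$-plectic manifold, let $(E,\rho,[-,-])$ be a Lie algebroid over $M$, and let $\nabla$ be a connection on the vector bundle $E$. Let $\mu=\sum_{k=0}^{n-1}\mu_k$, with $\mu_k\in\Omega^k(M,\wedge^{n-k}E^* )$, be a homotopy momentum section. Then its component $\mu_0\in\Gamma(\wedge^nE^* )$ is a compatible $E$-$n$-form, that is, ${}^E\mathrm{d}\mu_0=-\iota_\rho^{n+1}\omega$.
   Context: A pre-$n$-plectic manifold is a manifold $M$ with a closed $(n+1)$-form $\omega$. A Lie algebroid $(E,\rho,[-,-])$ is a vector bundle with an anchor $\rho:E\to TM$ and a Lie bracket on $\Gamma(E)$ satisfying $[e_1,fe_2]=f[e_1,e_2]+(\rho(e_1)f)e_2$. The Lie algebroid differential on $\Gamma(\wedge^mE^* )$ is $${}^E\mathrm{d}\alpha(e_1,\dots,e_{m+1})=\sum_i(-1)^{i-1}\rho(e_i)\alpha(\dots,\check e_i,\dots)+\sum_{i<j}(-1)^{i+j}\alpha([e_i,e_j],\dots,\check e_i,\dots,\check e_j,\dots).$$ For $0\le k\le n+1$, $\iota_\rho^{k}\omega\in\Omega^{n+1-k}(M,\wedge^kE^* )$ is defined by $$\iota_\rho^k\omega(v_{k+1},\dots,v_{n+1})(e_1,\dots,e_k)=\omega(\rho(e_k),\dots,\rho(e_1),v_{k+1},\dots,v_{n+1}).$$ $\mathrm{d}^\nabla:\Omega^k(M,\wedge^mE^* )\to\Omega^{k+1}(M,\wedge^mE^* )$ is the exterior covariant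 derivative of the connection on $\wedge^mE^*$ induced by $\nabla$. The canonical $E$-connection on $TM$ is ${}^E\nabla_ev=[\rho(e),v]+\rho(\nabla_ve)$ for $e\in\Gamma(E)$, $v\in\mathfrak X(M)$. It induces an $E$-connection ${}^E\nabla$ on $\wedge^kT^*M$ by duality and the Leibniz rule, with ${}^E\nabla_ef=\rho(e)f$ on functions ($k=0$). The $E$-exterior covariant derivative ${}^E\mathrm{d}^\nabla:\Omega^k(M,\wedge^mE^* )\to\Omega^k(M,\wedge^{m+1}E^* )$ is $${}^E\mathrm{d}^\nabla\alpha(e_1,\dots,e_{m+1})=\sum_i(-1)^{i-1}\,{}^E\nabla_{e_i}\bigl(\alpha(\dots,\check e_i,\dots)\bigr)+\sum_{i<j}(-1)^{i+j}\alpha([e_i,e_j],\dots,\check e_i,\dots,\check e_j,\dots).$$ A formal sum $\mu=\sum_{k=0}^{n-1}\mu_k$, $\mu_k\in\Omega^k(M,\wedge^{n-k}E^* )$, is a homotopy momentum section if $$(\mathrm{d}^\nabla+{}^E\mathrm{d}^\nabla)\mu=-\sum_{k=0}^n\iota_\rho^{n+1-k}\omega,$$ an equality in $\bigoplus_{k=0}^{n}\Omega^k(M,\wedge^{n+1-k}E^* )$. $J\in\Gamma(\wedge^nE^* )$ is a compatible $E$-$n$-form if ${}^E\mathrm{d}J=-\iota_\rho^{n+1}\omega$. *)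

(* Defs.v *)
From HB Require Import structures.
From mathcomp Require Import all_boot all_order all_algebra.
From mathcomp Require Import all_classical all_reals all_analysis.
From mathcomp Require Import ring.

Set Implicit Arguments.
Unset Strict Implicit.
Unset Printing Implicit Defensive.

Import Order.TTheory GRing.Theory Num.Theory.
Import numFieldNormedType.Exports.
Local Open Scope classical_set_scope.
Local Open Scope ring_scope.

(* All iterated partial derivatives of f up to order k exist and are
   continuous on U (meant for open U). *)
Fixpoint Ck (R : realType) (d k : nat) (U : set 'rV[R]_d)
    (f : 'rV[R]_d -> R) : Prop :=
  (forall x, U x -> {for x, continuous f}) /\
  if k is k'.+1 then
    forall i : 'I_d, (forall x, U x -> derivable f x 'e_i) /\
                     Ck k' U ('D_'e_i f)
  else True.

Lemma Ck_subset (R : realType) (d k : nat) (U V : set 'rV[R]_d) f :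
  V `<=` U -> Ck k U f -> Ck k V f.
Proof.
move=> VU; elim: k f => [|k IH] f [fc fD]; split=> //.
- by move=> x /VU; apply: fc.
- by move=> x /VU; apply: fc.
- move=> i; have [fd fCk] := fD i; split; last exact: IH.
  by move=> x /VU; apply: fd.
Qed.

Section CkTheory.
Variables (R : realType) (d : nat) (U : set 'rV[R]_d).
Hypothesis Uo : open U.
Implicit Types f g : 'rV[R]_d -> R.

Lemma Ck_ext k f g : (forall x, U x -> f x = g x) -> Ck k U f -> Ck k U g.
Proof.
have near_fg f' g' x : (forall x, U x -> f' x = g' x) -> U x ->
    \near x, f' x = g' x.
  by move=> fg Ux; apply: filterS (open_nbhs_nbhs (conj Uo Ux)).
elim: k f g => [|k IH] f g fg [fc fD]; split.
- move=> x Ux; rewrite /prop_for /continuous_at -fg//.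
  exact: cvg_trans (near_eq_cvg (near_fg _ _ _ fg Ux)) (fc x Ux).
- by [].
- move=> x Ux; rewrite /prop_for /continuous_at -fg//.
  exact: cvg_trans (near_eq_cvg (near_fg _ _ _ fg Ux)) (fc x Ux).
- move=> i; have [fd fCk] := fD i; split.
    by move=> x Ux; apply: near_eq_derivable (near_fg _ _ _ fg Ux) (fd x Ux).
  by apply: IH fCk => x Ux; apply: near_eq_derive; apply: near_fg.
Qed.

Lemma CkW k f : Ck k.+1 U f -> Ck k U f.
Proof.
elim: k f => [|k IH] f [fc fD]; split=> // i.
by have [fd fCk] := fD i; split=> //; apply: IH.
Qed.

Lemma Ck_cst k (a : R) : Ck k U (cst a).
Proof.
elim: k a => [|k IH] a; split=> //.
- by move=> x _; apply: cst_continuous.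
- by move=> x _; apply: cst_continuous.
- move=> i; split=> [x _|]; first exact: derivable_cst.
  by apply: Ck_ext (IH 0) => x _; rewrite derive_cst.
Qed.

Lemma CkD k f g : Ck k U f -> Ck k U g -> Ck k U (f + g).
Proof.
elim: k f g => [|k IH] f g [fc fD] [gc gD]; split=> //.
- by move=> x Ux; apply: continuousD; [apply: fc|apply: gc].
- by move=> x Ux; apply: continuousD; [apply: fc|apply: gc].
- move=> i; have [fd fCk] := fD i; have [gd gCk] := gD i; split.
    by move=> x Ux; apply: derivableD; [apply: fd|apply: gd].
  by apply: Ck_ext (IH _ _ fCk gCk) => x Ux; rewrite deriveD//; [apply: fd|apply: gd].
Qed.

Lemma CkM k f g : Ck k U f -> Ck k U g -> Ck k U (f * g).
Proof.
elim: k f g => [|k IH] f g Cf Cg; have [fc fD] := Cf; have [gc gD] := Cg; split=> //.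
- by move=> x Ux; apply: continuousM; [apply: fc|apply: gc].
- by move=> x Ux; apply: continuousM; [apply: fc|apply: gc].
- move=> i; have [fd fCk] := fD i; have [gd gCk] := gD i; split.
    by move=> x Ux; apply: derivableM; [apply: fd|apply: gd].
  apply: Ck_ext (CkD (IH _ _ (CkW Cf) gCk) (IH _ _ (CkW Cg) fCk)) => x Ux.
  by rewrite deriveM//; [apply: fd|apply: gd].
Qed.

End CkTheory.

(* A homeomorphism from an open subset of T onto an open subset of R^d;
   both maps are total, with irrelevant values outside the given sets. *)
Record chart (R : realType) (T : topologicalType) (d : nat) := Chart {
  chart_dom : set T;
  chart_img : set 'rV[R]_d;
  chart_map :> T -> 'rV[R]_d;
  chart_inv : 'rV[R]_d -> T;
  chart_dom_open : open chart_dom;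
  chart_img_open : open chart_img;
  chart_map_img : forall p, chart_dom p -> chart_img (chart_map p);
  chart_inv_dom : forall x, chart_img x -> chart_dom (chart_inv x);
  chart_mapK : forall p, chart_dom p -> chart_inv (chart_map p) = p;
  chart_invK : forall x, chart_img x -> chart_map (chart_inv x) = x;
  chart_map_cont : forall p, chart_dom p -> {for p, continuous chart_map};
  chart_inv_cont : forall x, chart_img x -> {for x, continuous chart_inv}
}.

Record manifold (R : realType) := Manifold {
  mcarrier :> topologicalType;
  mdim : nat;
  m_hausdorff : hausdorff_space mcarrier;
  m_second_countable : @second_countable mcarrier;
  atlas : set (chart R mcarrier mdim);
  atlas_cover : forall p : mcarrier, exists2 c, atlas c & chart_dom c p;
  atlas_compat : forall c c', atlas c -> atlas c' -> forall k (j : 'I_mdim),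
    Ck k (chart_img c `&` chart_inv c @^-1` chart_dom c')
      (fun x => c' (chart_inv c x) 0 j)
}.

Definition smooth_on (R : realType) (M : manifold R) (U : set M) (f : M -> R) :=
  forall c, atlas c -> forall k,
    Ck k (chart_img c `&` chart_inv c @^-1` U) (f \o chart_inv c).

Section SmoothOn.
Variables (R : realType) (M : manifold R) (U : set M).
Hypothesis Uo : open U.

Lemma open_chart_preimage (c : chart R M (mdim M)) :
  open (chart_img c `&` chart_inv c @^-1` U).
Proof.
rewrite openE => x [cx Ux]; apply: filterI.
  by apply: open_nbhs_nbhs; split=> //; apply: chart_img_open.
by apply: (chart_inv_cont cx); apply: open_nbhs_nbhs.
Qed.

Lemma smooth_on_cst (a : R) : smooth_on U (cst a).
Proof. by move=> c _ k; exact: (Ck_cst (@open_chart_preimage c) k a). Qed.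

Lemma smooth_onD (f g : M -> R) :
  smooth_on U f -> smooth_on U g -> smooth_on U (f + g).
Proof.
move=> sf sg c cA k.
exact: (CkD (@open_chart_preimage c) (sf c cA k) (sg c cA k)).
Qed.

Lemma smooth_onM (f g : M -> R) :
  smooth_on U f -> smooth_on U g -> smooth_on U (f * g).
Proof.
move=> sf sg c cA k.
exact: (CkM (@open_chart_preimage c) (sf c cA k) (sg c cA k)).
Qed.

End SmoothOn.

Definition smooth (R : realType) (M : manifold R) : pred (M -> R) :=
  fun f => `[< smooth_on setT f >].

Record Cinf (R : realType) (M : manifold R) := MkCinf {
  Cinf_fun :> M -> R;
  CinfP : smooth Cinf_fun
}.

Section CinfStructure.
Variables (R : realType) (M : manifold R).

HB.instance Definition _ := [isSub for @Cinf_fun R M].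
HB.instance Definition _ := [Choice of Cinf M by <:].

Lemma smooth_subring : subring_closed (@smooth R M).
Proof.
have sM : {in @smooth R M &, forall f g, f * g \in @smooth R M}.
  by move=> f g /asboolP sf /asboolP sg; apply/asboolP; apply: smooth_onM => //; exact: openT.
have sD : {in @smooth R M &, forall f g, f + g \in @smooth R M}.
  by move=> f g /asboolP sf /asboolP sg; apply/asboolP; apply: smooth_onD => //; exact: openT.
have sC (a : R) : cst a \in @smooth R M.
  by apply/asboolP; apply: smooth_on_cst; exact: openT.
split=> // [|f g sf sg]; first exact: sC.
apply: sD => //; rewrite -mulN1r; apply: sM => //.
by rewrite (_ : -1 = cst (-1))//; apply/funext.
Qed.

HB.instance Definition _ :=
  GRing.SubChoice_isSubComPzRing.Build _ _ (Cinf M) smooth_subring.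

Lemma smooth_scale : GRing.subsemimod_closed (@smooth R M).
Proof.
have [s1 sB sM] := smooth_subring; split; last first.
  move=> a f sf; rewrite (_ : a *: f = cst a * f); last exact/funext.
  by apply: sM => //; apply/asboolP; apply: smooth_on_cst; exact: openT.
exact: GRing.subring_closed_semi smooth_subring.
Qed.

HB.instance Definition _ :=
  GRing.SubZmodule_isSubLmodule.Build _ _ _ (Cinf M) smooth_scale.

End CinfStructure.

(* Tangent vectors at p are the derivations of C^oo(M) at p. *)
Definition point_derivation (R : realType) (M : manifold R) (p : M) :
    pred (Cinf M -> R) :=
  fun D => `[< (forall (a : R) (f g : Cinf M), D (a *: f + g) = a * D f + D g) /\
               (forall f g : Cinf M, D (f * g) = D f * g p + f p * D g) >].

Record tangent (R : realType) (M : manifold R) (p : M) := MkTangent {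
  tangent_fun :> Cinf M -> R;
  tangentP : point_derivation p tangent_fun
}.

Section TangentStructure.
Variables (R : realType) (M : manifold R) (p : M).

HB.instance Definition _ := [isSub for @tangent_fun R M p].
HB.instance Definition _ := [Choice of tangent p by <:].

Lemma point_derivation_submod : GRing.subsemimod_closed (@point_derivation R M p).
Proof.
split; [split|].
- apply/asboolP; split=> [a f g|f g] /=; first by rewrite mulr0 addr0.
  by rewrite mul0r mulr0 addr0.
- move=> D D' /asboolP[Dl DM] /asboolP[D'l D'M]; apply/asboolP; split=> [a f g|f g].
    by rewrite !fctE Dl D'l mulrDr addrACA.
  by rewrite !fctE DM D'M mulrDl mulrDr addrACA.
- move=> b D /asboolP[Dl DM].
  have E f : (b *: D) f = b * D f by [].
  apply/asboolP; split=> [a f g|f g]; first by rewrite !E Dl mulrDr mulrCA.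
  by rewrite !E DM mulrDr mulrA mulrCA.
Qed.

HB.instance Definition _ :=
  GRing.SubChoice_isSubLmodule.Build R _ _ (tangent p) point_derivation_submod.

Lemma tangent_ext (v w : tangent p) : (forall f, v f = w f) -> v = w.
Proof. by move=> vw; apply/val_inj/funext. Qed.

End TangentStructure.

Record vfield (R : realType) (M : manifold R) := MkVfield {
  vfield_at :> forall p : M, tangent p;
  vfieldP : forall f : Cinf M, smooth (fun p => vfield_at p f)
}.

Definition vf_app (R : realType) (M : manifold R) (X : vfield M) (f : Cinf M) :
  Cinf M := MkCinf (vfieldP X f).

Section VfieldStructure.
Variables (R : realType) (M : manifold R).
Implicit Types (X Y Z : vfield M) (f g : Cinf M).

HB.instance Definition _ := gen_eqMixin (vfield M).
HB.instance Definition _ := gen_choiceMixin (vfield M).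

Lemma vfield_ext X Y : (forall p f, X p f = Y p f) -> X = Y.
Proof.
case: X Y => [X sX] [Y sY] /= XY.
have {}XY : X = Y by apply: functional_extensionality_dep => p; apply: tangent_ext.
by case: _ / XY in sY *; congr MkVfield; apply: Prop_irrelevance.
Qed.

Lemma vf_zero_subproof f : smooth (fun p : M => (0 : tangent p) f).
Proof. exact: (CinfP (0 : Cinf M)). Qed.
Definition vf_zero : vfield M := MkVfield vf_zero_subproof.

Lemma vf_opp_subproof X f : smooth (fun p => (- X p) f).
Proof. exact: (CinfP (- vf_app X f)). Qed.
Definition vf_opp X : vfield M := MkVfield (vf_opp_subproof X).

Lemma vf_add_subproof X Y f : smooth (fun p => (X p + Y p) f).
Proof. exact: (CinfP (vf_app X f + vf_app Y f)). Qed.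
Definition vf_add X Y : vfield M := MkVfield (vf_add_subproof X Y).

Lemma vf_scale_subproof g X f : smooth (fun p => (g p *: X p) f).
Proof. exact: (CinfP (g * vf_app X f)). Qed.
Definition vf_scale g X : vfield M := MkVfield (vf_scale_subproof g X).

Lemma vf_addA : associative vf_add.
Proof. by move=> X Y Z; apply: vfield_ext => p f /=; rewrite addrA. Qed.
Lemma vf_addC : commutative vf_add.
Proof. by move=> X Y; apply: vfield_ext => p f /=; rewrite addrC. Qed.
Lemma vf_add0 : left_id vf_zero vf_add.
Proof. by move=> X; apply: vfield_ext => p f /=; rewrite add0r. Qed.
Lemma vf_addN : left_inverse vf_zero vf_opp vf_add.
Proof. by move=> X; apply: vfield_ext => p f /=; rewrite addNr. Qed.

HB.instance Definition _ :=
  GRing.isZmodule.Build (vfield M) vf_addA vf_addC vf_add0 vf_addN.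

Lemma vf_scaleA f g X : vf_scale f (vf_scale g X) = vf_scale (f * g) X.
Proof. by apply: vfield_ext => p h /=; rewrite scalerA. Qed.
Lemma vf_scale1 : left_id 1 vf_scale.
Proof. by move=> X; apply: vfield_ext => p h /=; rewrite scale1r. Qed.
Lemma vf_scaleDr : right_distributive vf_scale +%R.
Proof. by move=> f X Y; apply: vfield_ext => p h /=; rewrite scalerDr. Qed.
Lemma vf_scaleDl X : {morph vf_scale^~ X : f g / f + g}.
Proof. by move=> f g; apply: vfield_ext => p h /=; rewrite scalerDl. Qed.

HB.instance Definition _ := GRing.Zmodule_isLmodule.Build (Cinf M) (vfield M)
  vf_scaleA vf_scale1 vf_scaleDr vf_scaleDl.

Definition lie_at X Y (p : M) : Cinf M -> R :=
  fun f => X p (vf_app Y f) - Y p (vf_app X f).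

Lemma tangentL (p : M) (v : tangent p) (a : R) f g :
  v (a *: f + g) = a * v f + v g.
Proof. by have /asboolP[+ _] := tangentP v; apply. Qed.

Lemma tangentM (p : M) (v : tangent p) f g : v (f * g) = v f * g p + f p * v g.
Proof. by have /asboolP[_] := tangentP v; apply. Qed.

Lemma tangentD (p : M) (v : tangent p) f g : v (f + g) = v f + v g.
Proof. by have := tangentL v 1 f g; rewrite scale1r mul1r. Qed.

Lemma vf_appL X (a : R) f g : vf_app X (a *: f + g) = a *: vf_app X f + vf_app X g.
Proof. by apply/val_inj/funext => p /=; rewrite tangentL. Qed.

Lemma vf_appM X f g : vf_app X (f * g) = vf_app X f * g + f * vf_app X g.
Proof. by apply/val_inj/funext => p /=; rewrite tangentM. Qed.

Lemma lie_at_subproof X Y p : point_derivation p (lie_at X Y p).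
Proof.
apply/asboolP; split=> [a f g|f g]; rewrite /lie_at.
  by rewrite !vf_appL !tangentL mulrBr opprD addrACA.
rewrite !vf_appM !tangentD !tangentM /=.
ring.
Qed.

Lemma vf_lie_subproof X Y f :
  smooth (fun p => MkTangent (lie_at_subproof X Y p) f).
Proof. exact: (CinfP (vf_app X (vf_app Y f) - vf_app Y (vf_app X f))). Qed.

Definition vf_lie X Y : vfield M := MkVfield (vf_lie_subproof X Y).

End VfieldStructure.

(* A vector bundle of rank r given by its fibres and local trivialisations. A
   trivialisation over U is a family of linear maps E_p -> R^r, bijective for p
   in U and irrelevant elsewhere; two of them differ by a smooth matrix. *)
Record vbundle (R : realType) (M : manifold R) := Vbundle {
  fiber :> M -> lmodType R;
  vrank : nat;
  triv : set (set M * (forall p, {linear fiber p -> 'rV[R]_vrank}))%type;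
  triv_open : forall t, triv t -> open t.1;
  triv_cover : forall p, exists2 t, triv t & t.1 p;
  triv_bij : forall t p, triv t -> t.1 p -> bijective (t.2 p);
  triv_compat : forall t t', triv t -> triv t' ->
    exists g : M -> 'M[R]_vrank,
      (forall i j, smooth_on (t.1 `&` t'.1) (fun p => g p i j)) /\
      (forall p x, t.1 p -> t'.1 p -> t'.2 p x = t.2 p x *m g p)
}.

Definition smooth_section (R : realType) (M : manifold R) (E : vbundle M)
    (s : forall p, E p) :=
  forall t, triv t -> forall j, smooth_on t.1 (fun p => t.2 p (s p) 0 j).

Record vsection (R : realType) (M : manifold R) (E : vbundle M) := MkVsection {
  vsection_at :> forall p, E p;
  vsectionP : smooth_section vsection_at
}.

Section VsectionStructure.
Variables (R : realType) (M : manifold R) (E : vbundle M).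
Implicit Types (s t : vsection E) (f g : Cinf M).

HB.instance Definition _ := gen_eqMixin (vsection E).
HB.instance Definition _ := gen_choiceMixin (vsection E).

Lemma vsection_ext s t : (forall p, s p = t p) -> s = t.
Proof.
case: s t => [s Hs] [t Ht] /= st.
have {}st : s = t by apply: functional_extensionality_dep => p.
by case: _ / st in Ht *; congr MkVsection; apply: Prop_irrelevance.
Qed.

Lemma smooth_on_Cinf (U : set M) f : smooth_on U f.
Proof.
move=> c cA k; have /asboolP/(_ c cA k) := CinfP f.
by apply: Ck_subset => x [].
Qed.

Lemma vs_scale_subproof f s : smooth_section (fun p => f p *: s p).
Proof.
move=> t tE j; under eq_fun do rewrite linearZ mxE.
by apply: smooth_onM; [exact: triv_open|exact: smooth_on_Cinf|exact: vsectionP].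
Qed.
Definition vs_scale f s : vsection E := MkVsection (vs_scale_subproof f s).

Lemma vs_add_subproof s s' : smooth_section (fun p => s p + s' p).
Proof.
move=> t tE j; under eq_fun do rewrite linearD mxE.
by apply: smooth_onD; [exact: triv_open|exact: vsectionP..].
Qed.
Definition vs_add s s' : vsection E := MkVsection (vs_add_subproof s s').

Lemma vs_zero_subproof : smooth_section (fun p => 0 : E p).
Proof.
move=> t tE j; under eq_fun do rewrite linear0 mxE.
by apply: smooth_on_cst; exact: triv_open.
Qed.
Definition vs_zero : vsection E := MkVsection vs_zero_subproof.

Definition vs_opp s := vs_scale (-1) s.

Lemma vs_addA : associative vs_add.
Proof. by move=> s t u; apply: vsection_ext => p /=; rewrite addrA. Qed.
Lemma vs_addC : commutative vs_add.
Proof. by move=> s t; apply: vsection_ext => p /=; rewrite addrC. Qed.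
Lemma vs_add0 : left_id vs_zero vs_add.
Proof. by move=> s; apply: vsection_ext => p /=; rewrite add0r. Qed.
Lemma vs_addN : left_inverse vs_zero vs_opp vs_add.
Proof. by move=> s; apply: vsection_ext => p /=; rewrite scaleN1r addNr. Qed.

HB.instance Definition _ :=
  GRing.isZmodule.Build (vsection E) vs_addA vs_addC vs_add0 vs_addN.

Lemma vs_scaleA f g s : vs_scale f (vs_scale g s) = vs_scale (f * g) s.
Proof. by apply: vsection_ext => p /=; rewrite scalerA. Qed.
Lemma vs_scale1 : left_id 1 vs_scale.
Proof. by move=> s; apply: vsection_ext => p /=; rewrite scale1r. Qed.
Lemma vs_scaleDr : right_distributive vs_scale +%R.
Proof. by move=> f s t; apply: vsection_ext => p /=; rewrite scalerDr. Qed.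
Lemma vs_scaleDl s : {morph vs_scale^~ s : f g / f + g}.
Proof. by move=> f g; apply: vsection_ext => p /=; rewrite scalerDl. Qed.

HB.instance Definition _ := GRing.Zmodule_isLmodule.Build (Cinf M) (vsection E)
  vs_scaleA vs_scale1 vs_scaleDr vs_scaleDl.

End VsectionStructure.

Record lie_algebroid (R : realType) (M : manifold R) (E : vbundle M) :=
  LieAlgebroid {
  anchor : forall p, {linear E p -> tangent p};
  anchor_smooth : forall (e : vsection E) (f : Cinf M),
    smooth (fun p => anchor p (e p) f);
  lbr : vsection E -> vsection E -> vsection E;
  lbr_linl : forall (a : R) (e1 e2 e : vsection E),
    lbr ((a *: (1 : Cinf M)) *: e1 + e2) e =
    (a *: (1 : Cinf M)) *: lbr e1 e + lbr e2 e;
  lbr_linr : forall (a : R) (e e1 e2 : vsection E),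
    lbr e ((a *: (1 : Cinf M)) *: e1 + e2) =
    (a *: (1 : Cinf M)) *: lbr e e1 + lbr e e2;
  lbr_alt : forall e, lbr e e = 0;
  lbr_jacobi : forall e1 e2 e3,
    lbr e1 (lbr e2 e3) + lbr e2 (lbr e3 e1) + lbr e3 (lbr e1 e2) = 0;
  lbr_leibniz : forall (e1 e2 : vsection E) (f : Cinf M),
    lbr e1 (f *: e2) =
    f *: lbr e1 e2 + vf_app (MkVfield (anchor_smooth e1)) f *: e2
}.

Definition rho (R : realType) (M : manifold R) (E : vbundle M)
    (L : lie_algebroid E) (e : vsection E) : vfield M :=
  MkVfield (anchor_smooth L e).

Record connection (R : realType) (M : manifold R) (E : vbundle M) :=
  Connection {
  nabla :> vfield M -> vsection E -> vsection E;
  nabla_lin : forall (f : Cinf M) (X Y : vfield M) (e : vsection E),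
    nabla (f *: X + Y) e = f *: nabla X e + nabla Y e;
  nabla_add : forall (X : vfield M) (e1 e2 : vsection E),
    nabla X (e1 + e2) = nabla X e1 + nabla X e2;
  nabla_leibniz : forall (X : vfield M) (f : Cinf M) (e : vsection E),
    nabla X (f *: e) = f *: nabla X e + vf_app X f *: e
}.

Definition alt_multilinear (R : realType) (V : lmodType R) (k : nat)
    (a : ('I_k -> V) -> R) : Prop :=
  (forall (v : 'I_k -> V) (i : 'I_k) (c : R) (x y : V),
     a [eta v with i |-> c *: x + y] =
     c * a [eta v with i |-> x] + a [eta v with i |-> y]) /\
  (forall v (i j : 'I_k), i != j -> v i = v j -> a v = 0).

Record dform (R : realType) (M : manifold R) (k : nat) := Dform {
  dform_at : forall p : M, ('I_k -> tangent p) -> R;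
  dform_alt : forall p, alt_multilinear (dform_at (p := p));
  dform_smooth : forall v : 'I_k -> vfield M,
    smooth (fun p => dform_at (v^~ p))
}.

(* The space Omega^k(M, /\^m E^* ): at p, a form takes k tangent vectors and m
   elements of E_p, and is alternating multilinear in each group separately.
   Smoothness is tested on global vector fields and sections. *)
Record Eform (R : realType) (M : manifold R) (E : vbundle M) (k m : nat) :=
  MkEform {
  Eform_at : forall p : M, ('I_k -> tangent p) -> ('I_m -> E p) -> R;
  Eform_altl : forall p e, alt_multilinear (fun v => Eform_at (p := p) v e);
  Eform_altr : forall p v, alt_multilinear (Eform_at (p := p) v);
  Eform_smooth : forall (v : 'I_k -> vfield M) (e : 'I_m -> vsection E),
    smooth (fun p => Eform_at (v^~ p) (e^~ p))
}.

(* Forms are compared, and the differential operators are given, through the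
   evaluation of forms on global vector fields and global sections; this
   is injective, since every tangent vector and every element of a fibre extends
   to a global field or section. *)
Definition dform_ev (R : realType) (M : manifold R) k (w : dform M k) :
    ('I_k -> vfield M) -> Cinf M :=
  fun v => MkCinf (dform_smooth w v).

Definition cochain (R : realType) (M : manifold R) (E : vbundle M) (k m : nat) :=
  ('I_k -> vfield M) -> ('I_m -> vsection E) -> Cinf M.

Definition Eform_ev (R : realType) (M : manifold R) (E : vbundle M) k m
    (a : Eform E k m) : cochain E k m :=
  fun v e => MkCinf (Eform_smooth a v e).

(* The arguments [e_i, e_j], e_0, .. (without e_i, e_j) .., e_m, for i < j. *)
Definition bracket_args (L : Type) (br : L -> L -> L) (m : nat)
    (e : 'I_m.+1 -> L) (i j : 'I_m.+1) : 'I_m -> L :=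
  fun s => if val s == 0%N then br (e i) (e j)
           else e (inord (bump j (bump i s.-1))).

(* The Koszul formula, with indices starting from 0 instead of 1. *)
Definition koszul (R : realType) (L : Type) (V : lmodType R)
    (br : L -> L -> L) (act : L -> V -> V) (m : nat) (a : ('I_m -> L) -> V) :
    ('I_m.+1 -> L) -> V :=
  fun e =>
    \sum_(i < m.+1) (-1) ^+ i *: act (e i) (a (fun s => e (lift i s))) +
    \sum_(i < m.+1) \sum_(j < m.+1 | (i < j)%N)
      (-1) ^+ (i + j) *: a (bracket_args br e i j).

Definition de_rham (R : realType) (M : manifold R) (k : nat)
    (a : ('I_k -> vfield M) -> Cinf M) : ('I_k.+1 -> vfield M) -> Cinf M :=
  koszul (@vf_lie R M) (@vf_app R M) a.

Definition preplectic (R : realType) (M : manifold R) (n : nat)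
    (w : dform M n.+1) : Prop :=
  de_rham (dform_ev w) = 0.

(* A formal sum of forms is the family of its components of bidegree (k', m');
   this is the one whose only term is a. *)
Definition single (R : realType) (M : manifold R) (E : vbundle M) (k m : nat)
    (a : cochain E k m) (k' m' : nat) : cochain E k' m' :=
  match k =P k', m =P m' with
  | ReflectT hk, ReflectT hm =>
      ecast i (cochain E i m') hk (ecast i (cochain E k i) hm a)
  | _, _ => 0
  end.
Arguments single {R M E k m} a k' m'.

Section Operators.
Variables (R : realType) (M : manifold R) (E : vbundle M).
Variables (L : lie_algebroid E) (D : connection E).
Local Notation X := (vfield M).
Local Notation G := (vsection E).

(* The Lie algebroid differential on Gamma(/\^m E^* ) = Omega^0(M, /\^m E^* ). *)
Definition Ediff (m : nat) (a : cochain E 0 m) : cochain E 0 m.+1 :=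
  fun v => koszul (lbr L) (fun e f => vf_app (rho L e) f) (a v).

(* On /\^m E^*, by duality and the Leibniz rule. *)
Definition nabla_dual (m : nat) (v : X) (b : ('I_m -> G) -> Cinf M) :
    ('I_m -> G) -> Cinf M :=
  fun e => vf_app v (b e) - \sum_(j < m) b [eta e with j |-> D v (e j)].

Definition d_nabla (k m : nat) (a : cochain E k m) : cochain E k.+1 m :=
  koszul (@vf_lie R M) (@nabla_dual m) a.

Definition E_nabla (e : G) (v : X) : X := vf_lie (rho L e) v + rho L (D v e).

(* On /\^k T^*M, by duality and the Leibniz rule. *)
Definition E_nabla_dual (k : nat) (e : G) (b : ('I_k -> X) -> Cinf M) :
    ('I_k -> X) -> Cinf M :=
  fun v => vf_app (rho L e) (b v) -
           \sum_(j < k) b [eta v with j |-> E_nabla e (v j)].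

Definition E_d_nabla (k m : nat) (a : cochain E k m) : cochain E k m.+1 :=
  fun v e => koszul (lbr L) (@E_nabla_dual k) (fun e' v' => a v' e') e v.

(* iota_rho^k w (v_1, .., v_l)(e_1, .., e_k)
     = w(rho(e_k), .., rho(e_1), v_1, .., v_l), where k + l is the degree of w. *)
Definition iota_rho (n k l : nat) (kl : (k + l)%N = n) (w : dform M n) :
    cochain E l k :=
  fun v e => dform_ev w (fun i => match fintype.split (cast_ord (esym kl) i) with
    | inl j => rho L (e (rev_ord j))
    | inr j => v j
    end).

Definition homotopy_momentum_section (n : nat) (w : dform M n.+1)
    (mu : forall k : 'I_n, Eform E k (n - k)) : Prop :=
  forall p q : nat,
    \sum_(k < n) (single (d_nabla (Eform_ev (mu k))) p q +
                  single (E_d_nabla (Eform_ev (mu k))) p q) =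
    - \sum_(k < n.+1) single (iota_rho (subnK (ltnW (ltn_ord k))) w) p q.

Definition compatible_Eform (n : nat) (w : dform M n.+1) (J : Eform E 0 n) :
    Prop :=
  Ediff (Eform_ev J) = - iota_rho (addn0 n.+1) w.

End Operators.

(* mu_0 as an element of Omega^0(M, /\^n E^* ) = Gamma(/\^n E^* ). *)
Definition component0 (R : realType) (M : manifold R) (E : vbundle M) (n : nat)
    (n_gt0 : (0 < n)%N) (mu : forall k : 'I_n, Eform E k (n - k)) : Eform E 0 n :=
  ecast i (Eform E 0 i) (subn0 n) (mu (Ordinal n_gt0)).

(* Main.v *)
Require Import Defs.
From mathcomp Require Import all_boot all_order all_algebra.
From mathcomp Require Import all_classical all_reals all_analysis.

(** The defining equation of a homotopy momentum section is an equality of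
    formal sums, and its component of bidegree [(0, n.+1)], which contains no
    differential form on [M], is the compatibility condition for [mu_0].
    - The covariant derivative raises the form degree, so it contributes nothing
      in form degree 0.
    - The E-exterior covariant derivative keeps the form degree, so only [mu_0]
      contributes through it. On functions the E-connection is
      differentiation along the anchor, so this derivative of [mu_0] is its Lie
      algebroid differential ([E_d_nabla0]).
    - On the right only the full contraction of [w] with the anchor has form
      degree 0.
    The remaining work is transport along equalities of degrees: the component
    [mu_0] has algebroid degree [n - 0] instead of [n]. *)

Import GRing.Theory.
Local Open Scope ring_scope.

Section Single.
Context {R : realType} {M : manifold R} {E : vbundle M}.

Lemma single_id (k m : nat) (a : cochain E k m) : single a k m = a.
Proof.
rewrite /single; case: eqP => // hk; case: eqP => // hm.
by rewrite (eq_axiomK hk) (eq_axiomK hm).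
Qed.

Lemma single_neq (k m k' m' : nat) (a : cochain E k m) :
  k != k' -> single a k' m' = 0.
Proof. by rewrite /single; case: eqP. Qed.

End Single.

(** In form degree 0 the dual E-connection has no Leibniz correction terms: it
    is the derivation of functions along the anchor. The two Koszul formulas
    then differ only in where they are evaluated: one sums functions of the
    (empty) family of vector fields, the other sums their values. *)
Lemma E_d_nabla0 (R : realType) (M : manifold R) (E : vbundle M)
    (L : lie_algebroid E) (D : connection E) (m : nat) (a : cochain E 0 m) :
  E_d_nabla L D a = Ediff L a.
Proof.
apply/funext => v; apply/funext => e.
rewrite /E_d_nabla /Ediff /koszul fctE !fct_sumE; congr (_ + _).
  by apply: eq_bigr => i _; rewrite fctE /E_nabla_dual big_ord0 subr0.
by apply: eq_bigr => i _; rewrite fct_sumE.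
Qed.

(** The cast is along an arbitrary equality of degrees, so that it can be
    eliminated; it is used for [n - 0 = n]. *)
Lemma single_E_d_nabla0 (R : realType) (M : manifold R) (E : vbundle M)
    (L : lie_algebroid E) (D : connection E) (m n : nat) (mn : m = n)
    (b : Eform E 0 m) :
  single (E_d_nabla L D (Eform_ev b)) 0 n.+1 =
  Ediff L (Eform_ev (ecast i (Eform E 0 i) mn b)).
Proof. by case: n / mn; rewrite single_id E_d_nabla0. Qed.

Theorem proposition4p16 (R : realType) (n : nat) (n_gt0 : (0 < n)%N)
    (M : manifold R) (w : dform M n.+1) (w_preplectic : preplectic w)
    (E : vbundle M) (L : lie_algebroid E) (D : connection E)
    (mu : forall k : 'I_n, Eform E k (n - k)) :
  homotopy_momentum_section L D w mu ->
  compatible_Eform L w (component0 n_gt0 mu).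
Proof.
move=> /(_ 0%N n.+1).
rewrite (bigD1 (Ordinal n_gt0)) //= single_neq // add0r.
rewrite big1 => [|k k_neq0]; last by rewrite !single_neq ?addr0.
rewrite addr0 big_ord_recl big1 => [|k _]; last by rewrite single_neq.
rewrite addr0 (single_E_d_nabla0 _ _ _ L D _ _ (subn0 n)) => mu0E.
rewrite /compatible_Eform mu0E; congr (- _).
(* [n.+1 - 0] computes to [n.+1], so no cast is left on this side. *)
rewrite [LHS]single_id; congr (iota_rho _ _ _).
exact: eq_irrelevance.
Qed.
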